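(* Let $n\ge 1$ and let $p_1,\dots,p_n\in(0,1]$ be such that $R_1<1$. Then $$\mathcal{V}(p_1,\dots,p_n)\;\ge\; R_1\left(\frac{n}{n+R_1}\right)^n\;>\;R_1e^{-R_1}.$$
   Context: Consider the last-success game $\mathcal{G}(p_1,\dots,p_n)$: independent Bernoulli variables $I_1,\dots,I_n$ with $P(I_i=1)=p_i>0$ are observed sequentially, and the player wins if he stops on the last variable equal to $1$. Put $q_i=1-p_i$, $r_i=p_i/q_i$ (with $r_i=\infty$ if $p_i=1$), $R_k=\sum_{i=k}^n r_i\in[0,\infty]$ (empty sum $=0$). The optimal threshold is $\mathbf{s}=\max\{1\le k\le n: R_k\ge 1\}$ if $R_1\ge 1$, and $\mathbf{s}=1$ otherwise; it is optimal to stop on the first $1$ among $I_{\mathbf{s}},\dots,I_n$. The optimal win probability is $$\mathcal{V}(p_1,\dots,p_n)=\Big(\prod_{j=\mathbf{s}}^n q_j\Big)\Big(\sum_{i=\mathbf{s}}^n r_i\Big)\ \text{ if } p_{\mathbf{s}}<1,\qquad \mathcal{V}(p_1,\dots,p_n)=\prod_{j=\mathbf{s}+1}^n q_j\ \text{ if } p_{\mathbf{s}}=1$$ (empty product $=1$). *)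

(* Defs.v *)
From HB Require Import structures.
From mathcomp Require Import all_boot all_order all_algebra.
From mathcomp Require Import all_classical all_reals all_analysis.

Set Implicit Arguments.
Unset Strict Implicit.
Unset Printing Implicit Defensive.

Import Order.TTheory GRing.Theory Num.Theory.
Local Open Scope ring_scope.

(* The variables I_1, ..., I_n are indexed by 'I_n, so that
   I_(i+1) is the coordinate i of an outcome. *)

Definition outcome (n : nat) := {ffun 'I_n -> bool}.

Definition outcome_prob (R : realType) (n : nat) (p : 'I_n -> R)
    (w : outcome n) : R :=
  \prod_(i < n) (if w i then p i else 1 - p i).

(* The player stops at time k when the strategy returns Some k, and never stops
   when it returns None. *)
Definition strategy (n : nat) := {ffun outcome n -> option 'I_n}.

(* The decision to stop at time k depends only on the variables observed up to
   and including time k. *)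
Definition stopping_rule (n : nat) (tau : strategy n) : bool :=
  [forall w : outcome n, forall w' : outcome n, forall k : 'I_n,
    [forall i : 'I_n, (i <= k)%N ==> (w i == w' i)] ==>
    (tau w == Some k) ==> (tau w' == Some k)].

Definition last_success (n : nat) (w : outcome n) (k : 'I_n) : bool :=
  w k && [forall j : 'I_n, (k < j)%N ==> ~~ w j].

Definition wins (n : nat) (tau : strategy n) (w : outcome n) : bool :=
  if tau w is Some k then last_success w k else false.

Definition win_prob (R : realType) (n : nat) (p : 'I_n -> R)
    (tau : strategy n) : R :=
  \sum_(w : outcome n | wins tau w) outcome_prob p w.

(* There are finitely many stopping rules, and the one that never stops wins
   with probability 0, so the default value 0 of the maximum is harmless. *)
Definition optimal_win_prob (R : realType) (n : nat) (p : 'I_n -> R) : R :=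
  \big[Num.max/0]_(tau : strategy n | stopping_rule tau) win_prob p tau.

Definition odds (R : realType) (x : R) : \bar R :=
  if x == 1 then +oo%E else (x / (1 - x))%:E.

Definition total_odds (R : realType) (n : nat) (p : 'I_n -> R) : \bar R :=
  (\sum_(i < n) odds (p i))%E.

(* Main.v *)
Require Import Defs.
From mathcomp Require Import all_boot all_order all_algebra.
From mathcomp Require Import all_classical all_reals all_analysis.
From mathcomp Require Import ring lra.

(** When R_1 < 1 the rule "stop at the first success" wins exactly when there
    is a single success, that is with probability (prod q_j) R_1.  Since
    q_j = 1 / (1 + r_j), AM-GM applied to the factors 1 + r_j bounds the
    product below by (n / (n + R_1))^n, and 1 + x < e^x at x = R_1 / n gives
    the strict inequality. *)

Import Order.TTheory GRing.Theory Num.Theory.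
Local Open Scope ring_scope.

Definition first_success {n : nat} (w : outcome n) (k : 'I_n) : bool :=
  w k && [forall j : 'I_n, (j < k)%N ==> ~~ w j].

Definition first_success_rule (n : nat) : strategy n :=
  [ffun w => [pick k | first_success w k]].

Definition single_success {n : nat} (i : 'I_n) : outcome n :=
  [ffun j => j == i].

(** Of two distinct first successes the smaller would have to be a failure. Hence the choice made by
    [pick] in [first_success_rule] is forced. *)
Lemma first_success_inj {n : nat} (w : outcome n) (k l : 'I_n) :
  first_success w k -> first_success w l -> k = l.
Proof.
move=> /andP[wk /forallP fk] /andP[wl /forallP fl]; apply: val_inj => /=.
case: (ltngtP k l) => // lt.
- by have := implyP (fl k) lt; rewrite wk.
- by have := implyP (fk l) lt; rewrite wl.
Qed.

Lemma first_success_ruleP {n : nat} (w : outcome n) (k : 'I_n) :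
  (first_success_rule n w == Some k) = first_success w k.
Proof.
rewrite ffunE; case: pickP => [l fl|->//].
apply/eqP/idP => [[<-]//|fk].
by rewrite (first_success_inj _ _ _ fl fk).
Qed.

(** Whether [k] is the first success is decided by the coordinates up to [k] alone. *)
Lemma stopping_first_success_rule (n : nat) :
  stopping_rule (first_success_rule n).
Proof.
apply/forallP => w; apply/forallP => w'; apply/forallP => k.
rewrite !first_success_ruleP.
apply/implyP => /forallP ww'; apply/implyP => /andP[wk /forallP fk].
have eqw (j : 'I_n) : (j <= k)%N -> w j = w' j.
  by move=> jk; apply/eqP; exact: implyP (ww' j) jk.
rewrite /first_success -eqw // wk; apply/forallP => j; apply/implyP => jk.
by rewrite -eqw ?(ltnW jk) //; exact: implyP (fk j) jk.
Qed.

Lemma wins_single_success (n : nat) (i : 'I_n) :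
  wins (first_success_rule n) (single_success i).
Proof.
rewrite /wins; have /eqP -> : first_success_rule n (single_success i) == Some i.
  rewrite first_success_ruleP /first_success ffunE eqxx /=.
  apply/forallP => j; apply/implyP => ji; rewrite ffunE.
  by apply: contraTneq ji => ->; rewrite ltnn.
rewrite /last_success ffunE eqxx /=.
apply/forallP => j; apply/implyP => ij; rewrite ffunE.
by apply: contraTneq ij => ->; rewrite ltnn.
Qed.

Lemma single_success_inj (n : nat) : injective (@single_success n).
Proof.
move=> i j /ffunP/(_ i); rewrite !ffunE eqxx => /esym/eqP; exact.
Qed.

(** Writing [p i] as its odds times [1 - p i] supplies the factor missing from the full product of
    the [1 - p j]. *)
Lemma outcome_prob_single_success (R : realType) (n : nat) (p : 'I_n -> R)
    (i : 'I_n) : p i != 1 ->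
  outcome_prob p (single_success i) =
  p i / (1 - p i) * \prod_(j < n) (1 - p j).
Proof.
move=> pi1; rewrite /outcome_prob (bigD1 i) //= [in RHS](bigD1 i) //=.
rewrite ffunE eqxx mulrA divfK ?subr_eq0 1?eq_sym //; congr (_ * _).
by apply: eq_bigr => j /negPf ji; rewrite ffunE ji.
Qed.

(** The single-success outcomes are distinct and all winning; any other winning outcome adds a
    nonnegative term. *)
Lemma win_prob_first_success_rule_ge (R : realType) (n : nat) (p : 'I_n -> R) :
  (forall i, 0 <= p i < 1) ->
  (\sum_(i < n) p i / (1 - p i)) * \prod_(j < n) (1 - p j)
    <= win_prob p (first_success_rule n).
Proof.
move=> hp; rewrite mulr_suml.
under eq_bigr => i _.
  rewrite -outcome_prob_single_success; last by case/andP: (hp i) => _ /lt_eqF ->.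
  over.
rewrite /win_prob.
(* Injectivity turns the sum over indices into a sum over a set of outcomes, to be compared with the
   set of winning ones. *)
rewrite -(big_imset (outcome_prob p) (in2W (@single_success_inj n))) /=.
rewrite [leRHS](bigID (mem [set single_success i | i in 'I_n]%SET)) /=.
rewrite [X in _ <= X + _](_ : _ =
    \sum_(w in [set single_success i | i in 'I_n]%SET) outcome_prob p w); last first.
  apply: eq_bigl => w; case: imsetP => [[i _ ->]|]; last by rewrite andbF.
  by rewrite wins_single_success.
rewrite lerDl; apply: sumr_ge0 => w _; apply: prodr_ge0 => i _.
by have /andP[p0 /ltW p1] := hp i; case: ifP => // _; rewrite subr_ge0.
Qed.

Lemma odds_ge0 (R : realType) (x : R) : 0 <= x <= 1 -> (0 <= odds x)%E.
Proof.
move=> /andP[x0 x1]; rewrite /odds; case: ifP => // _.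
by rewrite lee_fin divr_ge0 // subr_ge0.
Qed.

(** One [p i] equal to 1 contributes [+oo], which the other, nonnegative, odds cannot cancel. *)
Lemma total_odds_lty (R : realType) (n : nat) (p : 'I_n -> R) :
  (forall i, 0 <= p i <= 1) -> (total_odds p < +oo)%E -> forall i, p i < 1.
Proof.
move=> hp hR i; have /andP[_ p1] := hp i; rewrite lt_neqAle p1 andbT.
apply: contraTneq hR => pi1; rewrite /total_odds (bigD1 i) //= /odds pi1 eqxx.
rewrite addye ?ltxx // gt_eqF // (lt_le_trans ltNy0) //.
by apply: sume_ge0 => j _; exact: odds_ge0.
Qed.

Lemma total_oddsE (R : realType) (n : nat) (p : 'I_n -> R) :
  (forall i, p i < 1) -> total_odds p = (\sum_(i < n) p i / (1 - p i))%:E.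
Proof.
move=> hp; rewrite /total_odds -sumEFin; apply: eq_bigr => i _.
by rewrite /odds lt_eqF.
Qed.

Lemma prod_complement_ge (R : realType) (n : nat) (p : 'I_n -> R) :
  (0 < n)%N -> (forall i, 0 <= p i < 1) ->
  (n%:R / (n%:R + \sum_(i < n) p i / (1 - p i))) ^+ n
    <= \prod_(j < n) (1 - p j).
Proof.
move=> n0 hp; set r := fun i => p i / (1 - p i).
have q0 i : 0 < 1 - p i by have /andP[_] := hp i; rewrite subr_gt0.
have r0 i : 0 <= r i.
  by rewrite divr_ge0 ?(ltW (q0 i)) //; have /andP[] := hp i.
have qE i : 1 - p i = (1 + r i)^-1.
  have := q0 i; rewrite /r => qi.
  by apply: (mulIf (lt0r_neq0 qi)); field; rewrite lt0r_neq0 //=; lra.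
rewrite [leRHS](eq_bigr (fun i => (1 + r i)^-1)) // prodfV.
rewrite -[n%:R / _]invf_div exprVn.
have npos : 0 < n%:R :> R by rewrite ltr0n.
rewrite lef_pV2 ?posrE; last 2 first.
- rewrite exprn_gt0 // divr_gt0 // ltr_wpDr //.
  by apply: sumr_ge0 => i _; exact: r0.
- by apply: prodr_gt0 => i _; rewrite ltr_wpDr.
(* After inversion the goal bounds the product of the [1 + r i] by the [n]-th power of their
   mean. *)
have [+ _] := @leif_AGM _ _ (mem 'I_n) (fun i => 1 + r i)
  (fun i _ => addr_ge0 ler01 (r0 i)).
by rewrite card_ord big_split /= sumr_const card_ord.
Qed.

Lemma expRN_lt_pow (R : realType) (n : nat) (x : R) : (0 < n)%N -> 0 < x ->
  expR (- x) < (n%:R / (n%:R + x)) ^+ n.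
Proof.
move=> n0 x0; have npos : 0 < n%:R :> R by rewrite ltr0n.
rewrite expRN -[n%:R / _]invf_div exprVn ltf_pV2 ?posrE ?expR_gt0 //; last first.
  by rewrite exprn_gt0 // divr_gt0 // addr_gt0.
(* With both sides [n]-th powers, it remains to compare the bases [1 + x / n] and [expR (x / n)]. *)
have -> : expR x = expR (x / n%:R) ^+ n.
  by rewrite -expRM_natl mulrC divfK // gt_eqF.
rewrite mulrDl divff ?gt_eqF // ltrXn2r -?lt0n ?addr_ge0 ?divr_ge0 ?ltW //.
by rewrite expR_gt1Dx // gt_eqF // divr_gt0.
Qed.

Theorem theorem7 (R : realType) (n : nat) (p : 'I_n -> R)
    (hn : (1 <= n)%N)
    (hp : forall i : 'I_n, 0 < p i <= 1)
    (hR : (total_odds p < 1)%E) :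
  let R1 : R := fine (total_odds p) in
  optimal_win_prob p >= R1 * (n%:R / (n%:R + R1)) ^+ n /\
  R1 * (n%:R / (n%:R + R1)) ^+ n > R1 * expR (- R1).
Proof.
have p_lt1 : forall i, p i < 1.
  apply: total_odds_lty; last exact: lt_trans hR (ltry _).
  by move=> i; have /andP[/ltW -> ->] := hp i.
have p01 i : 0 <= p i < 1 by have /andP[/ltW -> _] := hp i; rewrite p_lt1.
have r_gt0 i : 0 < p i / (1 - p i).
  by have /andP[p0 _] := hp i; rewrite divr_gt0 // subr_gt0.
(* All odds being finite, [fine] returns the genuine real sum. *)
rewrite total_oddsE //=; set R1 := \sum_(i < n) _.
have R1_gt0 : 0 < R1.
  (* Since [n] is at least 1, index 0 exists, and its odds are strictly positive. *)
  rewrite /R1 (bigD1 (Ordinal hn)) //= ltr_pwDl // sumr_ge0 // => i _.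
  exact: ltW.
split; last by rewrite ltr_pM2l // expRN_lt_pow.
(* The optimum is a maximum over stopping rules, so this one rule bounds it from below. *)
apply: le_trans (le_bigmax_cond _ _ (stopping_first_success_rule n)).
apply: le_trans (win_prob_first_success_rule_ge R n p p01).
rewrite ler_wpM2l ?(ltW R1_gt0) //; exact: prod_complement_ge.
Qed.
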